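(* Let $C$ be a strictly convex function on $\mathbb{R}^n$ and assume that $C$ is $q$-homogeneous, i.e. $$\forall \lambda\geq 0,\ \forall x\in\mathbb{R}^n,\quad C(\lambda x)=\lambda^q C(x).$$ Let $p$ be defined by $1/p+1/q=1$ and let $\mathcal{L}=\int e^{-C(x)}dx$. Then for every smooth enough function $g$ on $\mathbb{R}^n$, $$\mathbf{Ent}_{dx}(e^g)\leq \frac{n}{p}\int e^g\,dx\;\log\left(\frac{p}{n e^{p-1}\mathcal{L}^{p/n}}\,\frac{\int C^*(-\nabla g)e^g\,dx}{\int e^g\,dx}\right).$$
   Context: $dx$ is Lebesgue measure on $\mathbb{R}^n$. The Fenchel–Legendre transform of $C$ is $C^*(x)=\sup_{z\in\mathbb{R}^n}\{x\cdot z-C(z)\}$. The entropy with respect to Lebesgue measure is $\mathbf{Ent}_{dx}(e^g)=\int e^g\log\frac{e^g}{\int e^g dx}\,dx$. In $e^{p-1}$, $e$ is Euler's number. ''Smooth enough'' is meant to include that the integrals involved exist. *)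

(* Defs.v *)
From HB Require Import structures.
From mathcomp Require Import all_boot all_order all_algebra.
From mathcomp Require Import all_classical all_reals all_analysis.
Import Order.TTheory GRing.Theory Num.Theory.
Import numFieldNormedType.Exports.

Set Implicit Arguments.
Unset Strict Implicit.
Unset Printing Implicit Defensive.

Local Open Scope classical_set_scope.
Local Open Scope ring_scope.

(* the library's instance of this fact is shadowed by the one for pairs of
   subprobabilities, hence is not found by inference *)
Lemma sigma_finite_product d1 d2 (T1 : measurableType d1)
    (T2 : measurableType d2) (R : realType)
    (m1 : {sigma_finite_measure set T1 -> \bar R})
    (m2 : {sigma_finite_measure set T2 -> \bar R}) :
  sigma_finite setT (m1 \x m2)%E.
Proof.
have /sigma_finiteP[F [TF ndF Foo]] := sigma_finiteT m1.
have /sigma_finiteP[G [TG ndG Goo]] := sigma_finiteT m2.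
exists (fun n => F n `*` G n).
  rewrite -setXTT TF TG predeqE => -[x y]; split.
    move=> [/= [n _ Fnx] [k _ Gky]]; exists (maxn n k) => //; split.
    - by move: x Fnx; exact/subsetPset/ndF/leq_maxl.
    - by move: y Gky; exact/subsetPset/ndG/leq_maxr.
  by move=> [n _ []/= ? ?]; split; exists n.
move=> k; have [? ?] := Foo k; have [? ?] := Goo k.
split; first exact: measurableX.
by rewrite product_measure1E// lte_mul_pinfty// ge0_fin_numE.
Qed.

Lemma sigma_finite_pushforward d1 d2 (T1 : measurableType d1)
    (T2 : measurableType d2) (R : realType) (m : set T1 -> \bar R)
    (f : T1 -> T2) (u : T2 -> T1) :
  measurable_fun setT u -> cancel f u -> sigma_finite setT m ->
  sigma_finite setT (pushforward m f).
Proof.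
move=> mu fK [F TF mF]; exists (fun k => u @^-1` F k).
  by rewrite -preimage_bigcup -TF preimage_setT.
move=> k; have [mFk Foo] := mF k; split.
  by rewrite -[X in measurable X]setTI; exact: mu.
rewrite /pushforward -comp_preimage (_ : u \o f = id) ?preimage_id//.
exact/funext.
Qed.

Section measurable_rV.
Context {R : realType} {n : nat}.

Let coors (i : 'I_n) (x : 'rV[R]_n) : measurableTypeR R := x 0 i.

Let rV_set0 : g_sigma_preimage coors set0.
Proof. exact: sigma_algebra0. Qed.

Let rV_setC A : g_sigma_preimage coors A -> g_sigma_preimage coors (~` A).
Proof. exact: sigma_algebraC. Qed.

Let rV_bigcup (F : (set 'rV[R]_n)^nat) :
  (forall i, g_sigma_preimage coors (F i)) ->
  g_sigma_preimage coors (\bigcup_i (F i)).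
Proof. exact: sigma_algebra_bigcup. Qed.

(* the product sigma-algebra of R^n, as the library does for n.-tuple T *)
HB.instance Definition _ :=
  @isMeasurable.Build (measure_tuple_display default_measure_display)
    'rV[R]_n (g_sigma_preimage coors) rV_set0 rV_setC rV_bigcup.

Lemma measurable_coord (i : 'I_n) :
  measurable_fun [set: 'rV[R]_n] (fun x : 'rV[R]_n => x 0 i).
Proof.
move=> _ Y mY; rewrite setTI; apply: sub_sigma_algebra => /=.
rewrite -bigcup_seq/=; exists i => /=; first by rewrite mem_index_enum.
by exists Y => //; rewrite setTI.
Qed.

Lemma measurable_fun_rVP d (T : measurableType d) (f : T -> 'rV[R]_n) :
  measurable_fun [set: T] f <->
  forall i, measurable_fun [set: T] (fun x => f x 0 i).
Proof.
split=> [mf i|mf].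
  exact: (measurableT_comp (measurable_coord i) mf).
move=> _ A; rewrite setTI.
have : g_sigma_preimage coors `<=` [set A | measurable (f @^-1` A)].
  apply: smallest_sub.
    split=> [/=|B mB /=|F mF /=].
    - by rewrite preimage_set0.
    - by rewrite setTD preimage_setC; exact: measurableC.
    - by rewrite preimage_bigcup; apply: bigcup_measurable => k _; exact: mF.
  rewrite -bigcup_seq => B [i _ [C mC <-]] /=.
  by rewrite setTI -[X in measurable X]setTI; exact: mf.
exact.
Qed.

End measurable_rV.

Section rVcons.
Context {R : realType} {n : nat}.

Definition rVcons (z : R * 'rV[R]_n) : 'rV[R]_n.+1 :=
  \row_i (if unlift ord0 i is Some j then z.2 0 j else z.1).

Definition rVuncons (x : 'rV[R]_n.+1) : R * 'rV[R]_n :=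
  (x 0 ord0, \row_j x 0 (lift ord0 j)).

Lemma rVconsK : cancel rVcons rVuncons.
Proof.
move=> [a v]; rewrite /rVuncons /rVcons mxE unlift_none; congr pair.
by apply/rowP => j; rewrite !mxE liftK.
Qed.

Lemma rVunconsK : cancel rVuncons rVcons.
Proof.
move=> x; apply/rowP => i; rewrite mxE.
by case: unliftP => [j ->|->] /=; rewrite ?mxE.
Qed.

Lemma measurable_rVcons :
  measurable_fun [set: measurableTypeR R * 'rV[R]_n] rVcons.
Proof.
apply/measurable_fun_rVP => i; rewrite /rVcons.
case: (unliftP ord0 i) => [j ->|->].
  under eq_fun do rewrite mxE liftK.
  exact: (measurableT_comp (measurable_coord j) measurable_snd).
under eq_fun do rewrite mxE unlift_none.
exact: measurable_fst.
Qed.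

Lemma measurable_rVuncons :
  measurable_fun [set: 'rV[R]_n.+1]
    (rVuncons : _ -> measurableTypeR R * 'rV[R]_n).
Proof.
apply: measurable_fun_pair; first exact: measurable_coord.
apply/measurable_fun_rVP => i; under eq_fun do rewrite mxE.
exact: measurable_coord.
Qed.

End rVcons.

Section lebesgue_rV.
Context {R : realType}.

Section step.
Context (n : nat) (m : {sigma_finite_measure set 'rV[R]_n -> \bar R}).

Definition lebesgue_rVS : set 'rV[R]_n.+1 -> \bar R :=
  pushforward (@lebesgue_measure R \x m)%E
    (rVcons : measurableTypeR R * 'rV[R]_n -> 'rV[R]_n.+1).

Let lebesgue_rVS0 : lebesgue_rVS set0 = 0%E.
Proof. by rewrite /lebesgue_rVS /pushforward preimage_set0 measure0. Qed.

Let lebesgue_rVS_ge0 A : (0 <= lebesgue_rVS A)%E.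
Proof. by rewrite /lebesgue_rVS /pushforward; exact: measure_ge0. Qed.

Let lebesgue_rVS_sigma_additive : semi_sigma_additive lebesgue_rVS.
Proof.
move=> F mF tF mUF; rewrite /lebesgue_rVS /pushforward preimage_bigcup.
apply: measure_semi_sigma_additive.
- by move=> k; rewrite -[X in measurable X]setTI; exact: measurable_rVcons.
- by apply/trivIsetP => /= i j _ _ ij; rewrite -preimage_setI;
    move/trivIsetP : tF => /(_ i j) ->//; rewrite preimage_set0.
- by rewrite -preimage_bigcup -[X in measurable X]setTI;
    exact: measurable_rVcons.
Qed.

HB.instance Definition _ := isMeasure.Build _ _ _ lebesgue_rVS
  lebesgue_rVS0 lebesgue_rVS_ge0 lebesgue_rVS_sigma_additive.

Let lebesgue_rVS_sigma_finite : sigma_finite setT lebesgue_rVS.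
Proof.
apply: (sigma_finite_pushforward measurable_rVuncons rVconsK).
exact: sigma_finite_product.
Qed.

HB.instance Definition _ := Measure_isSigmaFinite.Build _ _ _ lebesgue_rVS
  lebesgue_rVS_sigma_finite.

End step.

(* Lebesgue measure on R^n: the n-fold product of the one-dimensional one,
   transported along R * R^n ~ R^(n+1) *)
Fixpoint lebesgue_rV (n : nat) : {sigma_finite_measure set 'rV[R]_n -> \bar R} :=
  match n with
  | 0%N => @dirac _ _ (0 : 'rV[R]_0) R
  | n'.+1 => lebesgue_rVS (lebesgue_rV n')
  end.

(* together with sigma-finiteness, this value on measurable rectangles (in
   particular on boxes) characterizes Lebesgue measure *)
Lemma lebesgue_rV_rectangle n (A : 'I_n -> set (measurableTypeR R)) :
  (forall i, measurable (A i)) ->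
  lebesgue_rV n [set x | forall i, A i (x 0 i)] =
  (\prod_(i < n) lebesgue_measure (A i))%E.
Proof.
elim: n A => [A _|n IH A mA].
  rewrite big_ord0 /= /dirac /= indicE mem_set//=.
  by case.
rewrite big_ord_recl -IH// /= /lebesgue_rVS /pushforward.
rewrite -product_measure1E//; last first.
  rewrite [X in measurable X](_ : _ =
    \bigcap_(i in [set: 'I_n]) ((fun x : 'rV[R]_n => x 0 i) @^-1` A (lift ord0 i))).
    apply: fin_bigcap_measurable => // i _.
    rewrite -[X in measurable X]setTI; apply: measurable_coord => //.
    exact: mA.
  by apply/seteqP; split=> x /= h i => [_|]; exact: h.
congr (_ _); apply/seteqP; split=> -[a v] /=.
  move=> h; split; first by have := h ord0; rewrite mxE unlift_none.
  by move=> i; have := h (lift ord0 i); rewrite mxE liftK.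
move=> [ha hv] i; rewrite mxE.
by case: (unliftP ord0 i) => [j ->|->] //=.
Qed.

End lebesgue_rV.

Section calculus.
Context {R : realType} {n : nat}.
Implicit Types (C g : 'rV[R]_n -> R) (x y z : 'rV[R]_n).

Definition dotp x y : R := \sum_(i < n) x 0 i * y 0 i.

Definition strictly_convex C := forall x y (t : R),
  x != y -> 0 < t < 1 ->
  C (t *: x + (1 - t) *: y) < t * C x + (1 - t) * C y.

Definition homogeneous (q : R) C := forall (l : R) x,
  0 <= l -> C (l *: x) = l `^ q * C x.

(* the supremum is taken in the extended reals, hence is never a junk value *)
Definition legendre C x : \bar R :=
  ereal_sup [set (dotp x z - C z)%:E | z in [set: 'rV[R]_n]].

Definition grad g x : 'rV[R]_n := \row_(i < n) 'D_(delta_mx 0 i) g x.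

Definition continuously_differentiable g :=
  (forall x, differentiable g x) /\ continuous (grad g).

Definition Ent (f : 'rV[R]_n -> R) : R :=
  \int[lebesgue_rV n]_x (f x * ln (f x / \int[lebesgue_rV n]_y f y)).

End calculus.

(* Main.v *)
Require Import Defs.
From HB Require Import structures.
From mathcomp Require Import all_boot all_order all_algebra.
From mathcomp Require Import all_classical all_reals all_analysis.
From mathcomp Require Import measurable_realfun ring lra.

Set Implicit Arguments.
Unset Strict Implicit.
Unset Printing Implicit Defensive.

Import Order.TTheory GRing.Theory Num.Theory.
Import numFieldNormedType.Exports.

Local Open Scope classical_set_scope.
Local Open Scope ring_scope.

(** The proof transports [f = exp g] to a truncation of [exp (- C)], one
coordinate at a time.

In dimension one, let [T] be the monotone map that pushes a density [F] forward
to a multiple of a positive weight [w] on [[-M, M]], so that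
[T' = (A / I) F / w(T)] with [I] and [A] the two masses.  If
[H >= F ln (w(z) / F) - s z F'] for every [z] in [[-M, M]], then choosing
[z = T(t)] and using [ln x <= x - 1] at [x = s T'] gives
[H >= F (ln (A / I) + ln s + 1) - s (F T)'].  The last term integrates to
boundary values, which vanish along suitable sequences because [T] is bounded
and [F] is integrable.  Hence [I ln (A / I) + I + I ln s <= int H]
([transport_inequality_1d]).

This inequality tensorizes.  In dimension [n + 1], fix the first coordinates
[t] of [x] and [z1] of [z], apply the [n]-dimensional inequality to the remaining
coordinates, and observe that its conclusion is precisely the one-dimensional
hypothesis for the marginals of [f] and of the weight; this is
[dual_entropy_inequality].  Only the marginals are transported, as in Knothe's
construction, which avoids the regularity theory of optimal maps.  The marginal
of [f] need not be differentiable; the one-dimensional argument uses it only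
through integration by parts against C^1 functions, and that passes to
marginals by Fubini ([marginal_integration_by_parts]).

For the weight [exp (- C)] and [h = s^p legendre C (- grad g) f - f ln f], the
pointwise hypothesis is the Fenchel inequality combined with the
[p]-homogeneity of the Legendre transform.  The result is
[Ent f + I ln A_M + n I (1 + ln s) <= s^p J] for all [s > 0], where [A_M] is
the integral of [exp (- C)] over the cube of half-side [M].  Letting [M] grow
replaces [A_M] by [L] and shows that [L] is finite, and the choice
[s^p = n I / (p J)] yields the stated constant.  The parameter [s] plays the
role of a dilation of the space.

The strict convexity and homogeneity of [C] are used to show that [q > 1], that
[C] is nonnegative and that [C] is continuous. *)

(** * Integration on a measure space *)

Local Notation leb := lebesgue_measure.

Lemma ae_le_Rintegral d (T : measurableType d) (R : realType)
    (mu : {measure set T -> \bar R}) (D : set T) (f g : T -> R) :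
  measurable D -> mu.-integrable D (EFin \o f) ->
  mu.-integrable D (EFin \o g) ->
  {ae mu, forall x, D x -> f x <= g x} ->
  \int[mu]_(x in D) f x <= \int[mu]_(x in D) g x.
Proof.
move=> mD fi gi fg; rewrite -subr_ge0 -RintegralB//.
have gfi : mu.-integrable D (EFin \o (fun x => g x - f x)).
  exact: (integrableB mD gi fi).
rewrite (_ : Rintegral _ _ _ = \int[mu]_(x in D) `|g x - f x|) ?Rintegral_ge0//.
congr fine; apply: ae_eq_integral => //.
- exact: measurable_int gfi.
- exact: measurable_int (integrable_norm gfi).
- apply: filterS fg => x fg Dx /=; rewrite ger0_norm// subr_ge0; exact: fg.
Qed.

Lemma Rintegral_eq0_ae d (T : measurableType d) (R : realType)
    (mu : {measure set T -> \bar R}) (D : set T) (f : T -> R) :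
  measurable D -> mu.-integrable D (EFin \o f) ->
  (forall x, D x -> 0 <= f x) -> \int[mu]_(x in D) f x = 0 ->
  {ae mu, forall x, D x -> f x = 0}.
Proof.
move=> mD fi f0 If0.
have : ae_eq mu D (EFin \o f) (cst 0%E).
  apply/ae_eq_integral_abs => //; first exact: measurable_int fi.
  transitivity (\int[mu]_(x in D) (f x)%:E)%E.
    by apply: eq_integral => x /[!inE] Dx /=; rewrite ger0_norm ?f0.
  by rewrite -[LHS]fineK ?integrable_fin_num//; congr EFin.
by apply: filterS => x fx Dx; have [] := fx Dx.
Qed.

Lemma Rintegral_gt0 d (T : measurableType d) (R : realType)
    (mu : {measure set T -> \bar R}) (D : set T) (f : T -> R) :
  measurable D -> (0 < mu D)%E -> mu.-integrable D (EFin \o f) ->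
  (forall x, D x -> 0 < f x) -> 0 < \int[mu]_(x in D) f x.
Proof.
move=> mD D0 fi f0.
rewrite lt_def Rintegral_ge0 ?andbT; last by move=> x /f0/ltW.
apply/eqP => /Rintegral_eq0_ae -/(_ mD fi)[x /f0/ltW//|N [mN N0 DN]].
move: D0; rewrite ltNge => /negP; apply; rewrite -N0.
apply: le_measure; rewrite ?inE// => x Dx; apply: DN => /= /(_ Dx) fx0.
by have := f0 x Dx; rewrite fx0 ltxx.
Qed.

(** Otherwise [f >= e] on a set of infinite measure. *)
Lemma integrable_small_value d (T : measurableType d) (R : realType)
    (mu : {measure set T -> \bar R}) (D : set T) (f : T -> R) (e : R) :
  measurable D -> mu D = +oo%E -> mu.-integrable D (EFin \o f) -> 0 < e ->
  exists2 t, D t & f t < e.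
Proof.
move=> mD Doo fi e0; apply: contrapT => nf.
have ef t : D t -> e <= f t.
  by move=> Dt; rewrite leNgt; apply/negP => fe; apply: nf; exists t.
have /integrableP[mf] := fi; rewrite ltNge => /negP; apply.
apply: (@le_trans _ _ (\int[mu]_(x in D) e%:E)%E).
  by rewrite integral_cst// Doo gt0_muley.
apply: ge0_le_integral => //=.
- by move=> x _; rewrite lee_fin ltW.
- exact: measurable_int (integrable_norm fi).
- by move=> x Dx; rewrite lee_fin (le_trans (ef x Dx))// ler_norm.
Qed.

Lemma cvg_Rintegral_exhaust d (T : measurableType d) (R : realType)
    (mu : {measure set T -> \bar R}) (D : nat -> set T) (f : T -> R) :
  mu.-integrable setT (EFin \o f) -> (forall k, measurable (D k)) ->
  (forall x, \forall k \near \oo, D k x) ->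
  \int[mu]_(x in D k) f x @[k --> \oo] --> \int[mu]_x f x.
Proof.
move=> fi mD Dx; have mf := measurable_int mu fi.
pose fk k : T -> R := f \_ (D k).
have mfk k : measurable_fun [set: T] (EFin \o fk k).
  apply/measurable_EFinP; apply/(measurable_restrictT _ _).1 => //.
  exact/measurable_funTS/measurable_EFinP.
under eq_fun do rewrite Rintegral_mkcond.
rewrite /Rintegral; apply: fine_cvg; rewrite fineK; last exact: integrable_fin_num.
have [|||_ _ //] := @dominated_convergence _ _ R mu setT measurableT
  (fun k => EFin \o fk k) (EFin \o f) (abse \o (EFin \o f)) mfk mf.
- apply: aeW => x _; apply: cvg_near_cst.
  by apply: filterS (Dx x) => k Dkx /=; rewrite /fk patchE mem_set.
- exact: integrable_abse.
- apply: aeW => x k _ /=; rewrite /fk patchE; case: ifPn => //= _.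
  by rewrite normr0 lee_fin.
Qed.

(** An integrable extended real function is finite almost everywhere, so its
real-valued truncation carries the same integral. *)
Lemma integrable_fine d (T : measurableType d) (R : realType)
    (mu : {measure set T -> \bar R}) (h : T -> \bar R) :
  mu.-integrable setT h ->
  mu.-integrable setT (EFin \o (fine \o h)) /\
  (\int[mu]_x (fine (h x))%:E = \int[mu]_x h x)%E.
Proof.
move=> hi.
have mh : measurable_fun [set: T] (EFin \o (fine \o h)).
  apply/measurable_EFinP; apply: measurableT_comp; first exact: fine_measurable.
  exact: measurable_int hi.
have hE : ae_eq mu setT (EFin \o (fine \o h)) h.
  apply: filterS (integrable_ae measurableT hi) => x hx _ /=.
  by rewrite fineK// hx.
split; last by apply: ae_eq_integral => //; exact: measurable_int hi.
apply: le_integrable hi => // x _ /=.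
by case: (h x) => //=; rewrite normr0 leey.
Qed.

Lemma integrable_ae_eq d (T : measurableType d) (R : realType)
    (mu : {measure set T -> \bar R}) (f g : T -> \bar R) :
  measurable_fun setT g -> ae_eq mu setT f g ->
  mu.-integrable setT f -> mu.-integrable setT g.
Proof.
move=> mg fg fi; apply/integrableP; split => //.
have /integrableP[mf] := fi; congr (_ < _)%E.
apply: ae_eq_integral => //; [exact: measurableT_comp..|].
by apply: filterS fg => x fg Tx /=; rewrite fg.
Qed.

Lemma integrable_fubini_G d1 d2 (T1 : measurableType d1)
    (T2 : measurableType d2) (R : realType)
    (m1 : {sigma_finite_measure set T1 -> \bar R})
    (m2 : {sigma_finite_measure set T2 -> \bar R}) (f : T1 * T2 -> \bar R) :
  (m1 \x m2)%E.-integrable setT f ->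
  m2.-integrable setT (fun y => \int[m1]_x f (x, y))%E.
Proof.
move=> fi; have mf := measurable_int _ fi.
apply/integrableP; split; first exact: measurable_fubini_G fi.
apply: le_lt_trans ((integrable21ltyP m1 m2 mf).1 fi).
have mG : measurable_fun setT (fun y => `|\int[m1]_x f (x, y)|)%E.
  by apply: measurableT_comp => //; exact: measurable_fubini_G fi.
have mA : measurable_fun setT (fun y => \int[m1]_x `|f (x, y)|)%E.
  have := @measurable_fun_fubini_tonelli_G _ _ T1 T2 R m1 (abse \o f).
  by apply => //=; exact: measurableT_comp.
apply: ge0_le_integral => //.
move=> y _; apply: le_abse_integral => //.
exact: (measurableT_comp mf (pair2_measurable y)).
Qed.

(** * Monotone transport on the line *)

(** [T] is the quantile map: it solves [G (T t) = G (- M) + A / I * Phi t] for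
primitives [G] of [w] and [Phi] of [F].  The weight is positive on the whole
line, so that [G] is strictly increasing around [- M] and [M] too, and [T] is
differentiable even where it reaches an endpoint of the interval. *)
Lemma transport_map_to_interval (R : realType) (w F : R -> R) (M A I : R) :
  continuous w -> (forall z, 0 < w z) ->
  continuous F -> (forall t, 0 <= F t) -> leb.-integrable setT (EFin \o F) ->
  0 < M -> A = \int[leb]_(z in `[- M, M]) w z ->
  0 < I -> I = \int[leb]_t F t ->
  exists T : R -> R, (forall t, - M <= T t <= M) /\
    forall t, is_derive t (1 : R) T (A / I * F t / w (T t)).
Proof.
move=> cw w0 cF F0 iF M0 AE I0 IE.
(* starting the primitive at [- M - 1] makes [[- M, M]] interior to its domain *)
pose a := - M - 1.
have iw (x y : R) : leb.-integrable `[x, y] (EFin \o w).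
  apply: continuous_compact_integrable; first exact: segment_compact.
  exact: continuous_subspaceT.
pose G z := \int[leb]_(t in `[a, z]) w t.
have dG z : a < z -> is_derive z (1 : R) G (w z).
  move=> az; have [dGz <-] := @continuous_FTC1_closed R w a z (z + 1)
    ltac:(by rewrite ltrDl) (iw _ _) az (cw z).
  by rewrite derive1E; exact: derivableP.
have cG z : a < z -> {for z, continuous G}.
  by move=> /dG [+ _]; rewrite derivable1_diffP => /differentiable_continuous.
have G_lt x y : a < x -> x < y -> G x < G y.
  move=> ax xy; have [z||c cxy] := @MVT R G w x y xy.
  - rewrite in_itv/= => /andP[xz _]; apply: dG; exact: lt_trans xz.
  - apply: continuous_in_subspaceT => z; rewrite inE/= in_itv/= => /andP[xz _].
    by apply: cG; exact: lt_le_trans xz.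
  by rewrite -subr_gt0 => ->; rewrite mulr_gt0// subr_gt0.
have G_inj x y : a < x -> a < y -> G x = G y -> x = y.
  move=> ax ay Gxy; have [xy|yx|//] := ltgtP x y.
    by have := G_lt _ _ ax xy; rewrite Gxy ltxx.
  by have := G_lt _ _ ay yx; rewrite Gxy ltxx.
(* the inverse of [G] on the half-line where [G] is increasing *)
pose g y := xget 0 [set z | a < z /\ G z = y].
have gK z : a < z -> g (G z) = z.
  move=> az; rewrite /g; case: xgetP => [x _ [ax xz]|/(_ z) []//].
  exact: G_inj.
have GM : G M = G (- M) + A.
  have := @Rintegral_itvB R w (BLeft a) (BRight M) (- M) (iw a M).
  rewrite -/(G M) -/(G (- M)) Rintegral_itv_obnd_cbnd; last first.
    by apply: integrableS (iw a M) => //; apply: subset_itvr; rewrite bnd_simp /a; lra.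
  by rewrite -AE => <-; rewrite ?bnd_simp /a//; lra.
pose Phi t := \int[leb]_(s in `]-oo, t]) F s.
have iF' D : measurable D -> leb.-integrable D (EFin \o F).
  by move=> mD; exact: integrableS iF.
have dPhi t : is_derive t (1 : R) Phi (F t).
  have [dt <-] := @continuous_FTC1 R F -oo%O t (t + 1)
    ltac:(by rewrite ltrDl) (iF' _ (measurable_itv _)) ltac:(by rewrite ltNyr) (cF t).
  by rewrite derive1E; exact: derivableP.
have Phi01 t : 0 <= Phi t <= I.
  rewrite Rintegral_ge0//= IE /Rintegral fine_le//.
  - by apply: integrable_fin_num => //; exact: iF'.
  - exact: integrable_fin_num.
  - by apply: ge0_subset_integral => //=; [exact: (measurable_int leb)|
      move=> s _; rewrite lee_fin].
have A0 : 0 < A.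
  by rewrite -(ltrD2l (G (- M))) addr0 -GM; apply: G_lt; rewrite /a; lra.
pose y t := G (- M) + A / I * Phi t.
have Tex t : exists2 z, - M <= z <= M & G z = y t.
  have [|||z zM <-] := @IVT R G (- M) M (y t); first by lra.
  - apply: continuous_in_subspaceT => z; rewrite inE/= in_itv/= => /andP[zM _].
    by apply: cG; rewrite /a; lra.
  - have /andP[P0 P1] := Phi01 t.
    have yA : A / I * Phi t <= A.
      by rewrite mulrAC ler_pdivrMr// ler_wpM2l// ltW.
    have y0 : 0 <= A / I * Phi t by rewrite mulr_ge0// divr_ge0 ?ltW.
    rewrite GM /y minEle maxEle lerDl (ltW A0)/=; lra.
  by exists z => //; move: zM; rewrite in_itv.
exists (g \o y); split=> [t|t].
  have [z zM zy] := Tex t.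
  by rewrite -[(g \o y) t]/(g (y t)) -zy gK// /a; lra.
have [z zM zy] := Tex t.
have az : a < z by rewrite /a; lra.
rewrite -[(g \o y) t]/(g (y t)) -zy gK//.
have dg : is_derive (G z) (1 : R) g (w z)^-1.
  apply: is_derive_inverse.
  - near=> x; apply: gK; near: x; exact: lt_nbhsr.
  - near=> x; apply: cG; near: x; exact: lt_nbhsr.
  - exact: dG.
  - by rewrite gt_eqF.
rewrite zy in dg.
have dy : is_derive t (1 : R) y (A / I * F t).
  have := is_deriveD (is_derive_cst (G (- M)) t 1)
    (is_deriveZ (A / I) (dPhi t)).
  by rewrite add0r; apply.
rewrite mulrC; exact: is_derive1_comp.
Unshelve. all: by end_near.
Qed.

(** [phi] is the derivative of [F] only in the weak sense that integration by
parts holds against C^1 functions, which is what survives when [F] is a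
marginal.  With [T] the transport map, the choice [z = T t] bounds [H] below by
[c F - s (F T' + phi T)], where the bracket is a total derivative. *)
Lemma transport_inequality_1d (R : realType) (w F phi H : R -> R) (M s : R)
    (A := \int[leb]_(z in `[- M, M]) w z) (I := \int[leb]_t F t) :
  continuous w -> (forall z, 0 < w z) ->
  (forall t, 0 <= F t) ->
  leb.-integrable setT (EFin \o F) ->
  leb.-integrable setT (EFin \o phi) ->
  (forall T T' : R -> R, (forall t, is_derive t (1 : R) T (T' t)) ->
    continuous T' -> forall a b, a < b ->
    leb.-integrable `[a, b] (EFin \o (fun t => F t * T' t + phi t * T t)) /\
    \int[leb]_(t in `[a, b]) (F t * T' t + phi t * T t) = F b * T b - F a * T a) ->
  leb.-integrable setT (EFin \o H) ->
  0 < M -> 0 < s ->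
  {ae leb, forall t, forall z, - M <= z <= M ->
    F t * ln (w z / F t) - s * (z * phi t) <= H t} ->
  I * ln (A / I) + I + I * ln s <= \int[leb]_t H t.
Proof.
move=> cw w0 F0 iF iphi parts iH M0 s0 FH.
have I_ge0 : 0 <= I by exact: Rintegral_ge0.
have A0 : 0 < A.
  apply: Rintegral_gt0 => //=.
    by rewrite lebesgue_measure_itv/= lte_fin ifT ?lte_fin; lra.
  apply: continuous_compact_integrable; first exact: segment_compact.
  exact: continuous_subspaceT.
(* for [F = 0] almost everywhere, the hypothesis at [z = 0] reads [0 <= H] *)
have [I0|I0] := eqVneq I 0.
  rewrite I0 !mul0r !addr0.
  have F00 : {ae leb, forall t, setT t -> F t = 0} by exact: Rintegral_eq0_ae.
  rewrite -[leLHS](_ : \int[leb]_t (cst 0 t) = _); last first.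
    by rewrite Rintegral_cst// mul0r.
  apply: ae_le_Rintegral => //.
    exact: integrable0.
  apply: (@filterS2 _ _ (ae_filter_ringOfSetsType leb) _ _ _ _ F00 FH).
  move=> t /(_ Logic.I) /= Ft /(_ 0) + _.
  rewrite Ft !mul0r mulr0 subr0; apply.
  by rewrite oppr_le0 ltW//= ltW.
have {}I_gt0 : 0 < I by rewrite lt_def I0.
(* integration by parts against the constant 1 makes [F] a primitive of [phi] *)
have cF : continuous F.
  move=> x; have a1 : x - 1 < x + 1 by lra.
  have part1 a b : a < b -> leb.-integrable `[a, b] (EFin \o phi) /\
      \int[leb]_(t in `[a, b]) phi t = F b - F a.
    move=> ab.
    have d1 (t : R) : is_derive t (1 : R) (cst 1 : R -> R) (cst 0 t).
      exact: is_derive_cst.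
    have [] := parts _ _ d1 (@cst_continuous _ _ _) a b ab.
    rewrite (_ : (fun t => _) = phi) ?mulr1//.
    by apply/funext => t /=; rewrite mulr0 add0r mulr1.
  suff : {within `[x - 1, x + 1], continuous F}.
    by move=> /(continuous_within_itvP _ a1)[+ _ _]; apply; rewrite in_itv/=; lra.
  apply: (subspace_eq_continuous (f := fun y =>
      parameterized_integral leb (x - 1) y phi + F (x - 1))).
    move=> y; rewrite inE/= in_itv/= => /andP[+ _].
    rewrite le_eqVlt => /predU1P[<-|/part1[_ h]]; last first.
      by rewrite /parameterized_integral h subrK.
    by rewrite /parameterized_integral set_itv1 Rintegral_set1 add0r.
  move=> y; apply: cvgD; last exact: cvg_cst.
  exact: (parameterized_integral_continuous (ltW a1) (part1 _ _ a1).1).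
have [T [TM dT]] := transport_map_to_interval cw w0 cF F0 iF M0 erefl I_gt0 erefl.
rewrite -/A -/I in dT.
pose T' t := A / I * F t / w (T t).
have cT : continuous T.
  move=> t; have [+ _] := dT t.
  by rewrite derivable1_diffP => /differentiable_continuous.
have cT' : continuous T'.
  move=> t; apply: cvgM; first by apply: cvgMl_tmp; exact: cF.
  apply: cvgV; first by rewrite gt_eqF.
  exact: (continuous_comp (cT t) (cw _)).
have {}parts := parts T T' dT cT'.
pose c := ln (A / I) + ln s + 1.
have ptw t : c * F t - s * (F t * T' t + phi t * T t) <=
    F t * ln (w (T t) / F t) - s * (T t * phi t).
  rewrite [phi t * _]mulrC mulrDr opprD addrA lerD2r.
  have [->|Ft] := eqVneq (F t) 0; first by rewrite /T' !(mul0r,mulr0) subr0.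
  have {}Ft : 0 < F t by rewrite lt_def Ft F0.
  have T'0 : 0 < T' t by rewrite /T' !divr_gt0// mulr_gt0// divr_gt0.
  have -> : w (T t) / F t = (A / I) / T' t.
    by rewrite /T'; field; rewrite !gt_eqF.
  rewrite ln_div ?posrE ?T'0 ?divr_gt0//.
  have h : ln s + ln (T' t) <= s * T' t - 1.
    rewrite -lnM ?posrE// -[X in ln X](subrKC 1).
    by apply: le_ln1Dx; rewrite ltrBrDl subrr mulr_gt0.
  rewrite mulrCA [c * _]mulrC -mulrBr ler_pM2l// /c; lra.
have local a b : a < b -> c * \int[leb]_(t in `[a, b]) F t - s * M * (F a + F b) <=
    \int[leb]_(t in `[a, b]) H t.
  move=> ab; have [ip pE] := parts a b ab.
  have iFab : leb.-integrable `[a, b] (EFin \o F) by exact: integrableS iF.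
  have icF : leb.-integrable `[a, b] (EFin \o (fun t => c * F t)).
    exact: (@integrableZl _ _ _ leb _ _ c (EFin \o F)).
  have isp : leb.-integrable `[a, b] (EFin \o (fun t => s * (F t * T' t + phi t * T t))).
    exact: (@integrableZl _ _ _ leb _ _ s (EFin \o _) ip).
  apply: (@le_trans _ _ (\int[leb]_(t in `[a, b])
      (c * F t - s * (F t * T' t + phi t * T t)))).
    rewrite RintegralB//= !RintegralZl// pE lerD2l lerN2 -mulrA ler_pM2l//.
    have /andP[? ?] := TM a; have /andP[? ?] := TM b.
    have := F0 a; have := F0 b; nra.
  apply: ae_le_Rintegral => //.
  - exact: (integrableB _ icF isp).
  - exact: integrableS iH.
  - apply: (@filterS _ _ (ae_filter_ringOfSetsType leb) _ _ _ FH).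
    by move=> t /(_ (T t) (TM t)) + _; exact: le_trans.
(* an integrable function is small at points arbitrarily far on both sides;
   there the boundary terms [F T] disappear, as [T] is bounded *)
have ab k : exists ab : R * R, [/\ ab.1 <= - k%:R, k%:R <= ab.2,
   F ab.1 <= k.+1%:R^-1 & F ab.2 <= k.+1%:R^-1].
  have k0 : 0 < k.+1%:R^-1 :> R by rewrite invr_gt0.
  have small (i : interval R) : leb [set` i] = +oo%E ->
      exists2 t, t \in i & F t < k.+1%:R^-1.
    move=> ioo; apply: (integrable_small_value _ ioo _ k0).
      exact: measurable_itv.
    by apply: integrableS iF => //; exact: measurable_itv.
  have [|a ak Fa] := small `]-oo, - k%:R].
    by rewrite lebesgue_measure_itv/= ltNyr.
  have [|b bk Fb] := small `[k%:R, +oo[.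
    by rewrite lebesgue_measure_itv/= ltry.
  exists (a, b); move: ak bk; rewrite /= !in_itv/= andbT => ak kb.
  by split=> //; exact: ltW.
have {ab} [ab abP] := choice ab.
have nearab (x : R) : \forall k \near \oo, `[(ab k).1, (ab k).2]%classic x.
  near=> k; rewrite /= in_itv/=.
  have : `|x| <= k%:R by near: k; exact: nbhs_infty_ger.
  have [ak bk _ _] := abP k.
  rewrite ler_norml => /andP[kx xk].
  by rewrite (le_trans ak)//= (le_trans xk).
have lim1 : \int[leb]_(x in `[(ab k).1, (ab k).2]) H x @[k --> \oo] --> \int[leb]_x H x.
  exact: cvg_Rintegral_exhaust.
have lim2 : c * \int[leb]_(x in `[(ab k).1, (ab k).2]) F x - s * M * (2 * k.+1%:R^-1)
      @[k --> \oo] --> c * I - s * M * (2 * 0).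
  apply: cvgB; apply: cvgMl_tmp.
    exact: cvg_Rintegral_exhaust.
  apply: cvgMl_tmp; exact: cvg_harmonic.
have -> : I * ln (A / I) + I + I * ln s = c * I - s * M * (2 * 0) by rewrite /c; ring.
apply: ler_cvg_to lim2 lim1 _; near=> k.
have [ak bk Fa Fb] := abP k.
have : (ab k).1 < (ab k).2.
  have : 1 <= k%:R :> R by near: k; exact: nbhs_infty_ger.
  by move: ak bk; lra.
move=> /local; apply: le_trans; rewrite lerD2l lerN2 ler_wpM2l//.
  by rewrite mulr_ge0 ?ltW.
by rewrite mulrDl mul1r lerD.
Unshelve. all: by end_near.
Qed.

(** * Measurability and Fubini on row vectors *)

Lemma cvg_row (R : realType) (n : nat) (T : Type) (F : set_system T)
    (FF : Filter F) (u : T -> 'rV[R]_n) (l : 'rV[R]_n) :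
  (forall i, u x 0 i @[x --> F] --> l 0 i) -> u x @[x --> F] --> l.
Proof.
move=> ul; apply/cvg_ballP => e e0.
have : \forall x \near F, forall i, ball (l 0 i) e (u x 0 i).
  by apply: filter_forall => i; exact: (cvg_ball (ul i) e0).
by apply: filterS => x ux; split=> // i j; rewrite ord1.
Qed.

(** The measurable sets come from the coordinates and not from the topology.
Rounding the coordinates down to the grid of step [1 / (k + 1)] factors
[f] through a countable set, where everything is measurable, and these
approximations converge to [f] by continuity. *)
Lemma continuous_measurable_rV (R : realType) (n : nat) (f : 'rV[R]_n -> R) :
  continuous f -> measurable_fun [set: 'rV[R]_n] f.
Proof.
move=> cf.
pose fl k (x : 'rV[R]_n) : 'rV[int]_n := \row_i Num.floor (k.+1%:R * x 0 i).
pose emb k (c : 'rV[int]_n) : 'rV[R]_n := \row_i ((c 0 i)%:~R / k.+1%:R).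
apply: (measurable_fun_cvg (h := fun k => f \o (emb k \o fl k))); last first.
  move=> x _; suff embfl : emb k (fl k x) @[k --> \oo] --> x.
    exact: (cvg_comp _ _ embfl (cf x)).
  apply: (cvg_row (F := \oo)) => i; apply/cvgrPdist_lt => e e0.
  near=> k.
  rewrite !mxE.
  have k0 : 0 < k.+1%:R :> R by [].
  have -> : x 0 i - (Num.floor (k.+1%:R * x 0 i))%:~R / k.+1%:R =
     (k.+1%:R * x 0 i - (Num.floor (k.+1%:R * x 0 i))%:~R) / k.+1%:R.
    by field; rewrite gt_eqF.
  have /andP[f0 f1] := floor_itv (k.+1%:R * x 0 i).
  rewrite ger0_norm ?divr_ge0 ?subr_ge0//.
  apply: (@lt_trans _ _ (k.+1%:R^-1)).
    by rewrite ltr_pdivrMr// mulVf ?gt_eqF// ltrBlDl -intrD1.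
  near: k; exact: near_infty_natSinv_lt (PosNum e0).
move=> k _ Y mY; rewrite setTI.
rewrite (_ : _ @^-1` Y = \bigcup_(c : 'rV[int]_n)
   (if pselect (Y (f (emb k c))) then fl k @^-1` [set c] else set0)); last first.
  apply/seteqP; split=> [x Yx|x [c _]].
    by exists (fl k x) => //; case: pselect.
  by case: pselect => // Yc /= ->.
apply: countable_bigcupT_measurable => // c.
case: pselect => Yc /=; last exact: measurable0.
rewrite (_ : _ @^-1` _ = \bigcap_(i in [set: 'I_n])
  [set x : 'rV[R]_n | (c 0 i)%:~R <= k.+1%:R * x 0 i < (c 0 i + 1)%:~R]); last first.
  apply/seteqP; split=> [x <- i _|x xc] /=; first by rewrite mxE floor_itv.
  by apply/rowP => i; rewrite mxE; apply: floor_def; exact: xc.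
apply: fin_bigcap_measurable => // i _.
rewrite (_ : [set x | _] =
  (fun x : 'rV[R]_n => k.+1%:R * x 0 i) @^-1` `[(c 0 i)%:~R, (c 0 i + 1)%:~R[); last first.
  by apply/seteqP; split=> x /=; rewrite in_itv.
have mk : measurable_fun [set: 'rV[R]_n] (fun x => k.+1%:R * x 0 i).
  by apply: measurable_funM => //; exact: measurable_coord.
by rewrite -[X in measurable X]setTI; exact: mk.
Unshelve. all: by end_near.
Qed.

Section marginals.
Context {R : realType} {n : nat}.
Local Notation m := (@lebesgue_rV R n).

Lemma integrable_rVcons (f : 'rV[R]_n.+1 -> \bar R) :
  (lebesgue_rV n.+1).-integrable setT f ->
  (leb \x m)%E.-integrable setT (f \o rVcons).
Proof.
move=> /integrableP[mf foo]; apply/integrableP.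
have mfc : measurable_fun setT (f \o rVcons).
  exact: (measurableT_comp mf measurable_rVcons).
split=> //; move: foo; apply: le_lt_trans.
rewrite (ge0_integral_pushforward measurable_rVcons)//.
  exact: measurableT_comp.
Qed.

Lemma integral_rVcons (f : 'rV[R]_n.+1 -> \bar R) :
  (lebesgue_rV n.+1).-integrable setT f ->
  (\int[lebesgue_rV n.+1]_x f x = \int[leb]_t \int[m]_y f (rVcons (t, y)))%E.
Proof.
move=> fi; have fic := integrable_rVcons fi.
rewrite (integral12_prod_meas1 fic).
rewrite (integral_pushforward measurable_rVcons)//.
exact: measurable_int fi.
Qed.

End marginals.

(** * Marginals of functions that are C^1 in one variable *)

Section marginal_parts.
Context {R : realType} d (Y : measurableType d)
  (m : {sigma_finite_measure set Y -> \bar R}) (f f' : R * Y -> R).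
Hypothesis fi : (leb \x m)%E.-integrable setT (EFin \o f).
Hypothesis f'i : (leb \x m)%E.-integrable setT (EFin \o f').
Hypothesis df : forall y t, is_derive t (1 : R) (fun u => f (u, y)) (f' (t, y)).
Hypothesis cf' : forall y, continuous (fun t => f' (t, y)).

(** On a slab [[a, b] * Y] the test functions are bounded, so Fubini applies to
the derivative of [f T] in the first variable; integrating first along that
variable leaves boundary values. *)
Let slab (T T' : R -> R) (a b : R) (z : R * Y) : R :=
  f z * (T' \_ `[a, b]) z.1 + f' z * (T \_ `[a, b]) z.1.

Let integrableM_restrict (h : R * Y -> R) (T : R -> R) a b : continuous T ->
  (leb \x m)%E.-integrable setT (EFin \o h) ->
  (leb \x m)%E.-integrable setT (EFin \o (fun z => h z * (T \_ `[a, b]) z.1)).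
Proof.
move=> cT hi.
have mT : measurable_fun setT (T \_ `[a, b] : R -> R).
  apply/(measurable_restrictT _ _).1 => //; apply: measurable_funTS.
  exact: continuous_measurable_fun.
have mT1 : measurable_fun setT (fun z : R * Y => (T \_ `[a, b]) z.1).
  exact: (measurableT_comp mT measurable_fst).
apply: (@integrableMl _ _ _ (leb \x m)%E setT measurableT (EFin \o h) _ hi mT1).
have /compact_bounded : compact (T @` `[a, b]).
  apply: continuous_compact; first exact: continuous_subspaceT.
  exact: segment_compact.
move=> [B [_ BT]]; exists (Num.max B 0); split=> [|x]; first exact: num_real.
rewrite gt_max => /andP[Bx x0] z _ /=.
rewrite patchE; case: ifPn => [zab|_]; last by rewrite normr0 ltW.
by apply: BT => //; exists z.1 => //; exact: set_mem.
Qed.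

Let slabE T T' a b t y : slab T T' a b (t, y) =
  ((fun u => f (u, y) * T' u + f' (u, y) * T u) \_ `[a, b]) t.
Proof.
by rewrite /slab /= !patchE; case: ifPn => //; rewrite !mulr0 addr0.
Qed.

Let cf y : continuous (fun t => f (t, y)).
Proof.
by move=> t; have [+ _] := df y t; rewrite derivable1_diffP => /differentiable_continuous.
Qed.

Let slabi T T' a b : continuous T -> continuous T' ->
  (leb \x m)%E.-integrable setT (EFin \o slab T T' a b).
Proof.
by move=> cT cT'; apply: (@integrableD _ _ _ (leb \x m)%E _ measurableT _ _
  (integrableM_restrict a b cT' fi) (integrableM_restrict a b cT f'i)).
Qed.

Let slab_line T T' a b y : a < b ->
  (forall t, is_derive t (1 : R) T (T' t)) -> continuous T' ->
  (\int[leb]_t (slab T T' a b (t, y))%:E = (f (b, y) * T b - f (a, y) * T a)%:E)%E.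
Proof.
move=> ab dT cT'.
have cT : continuous T.
  by move=> t; have [+ _] := dT t; rewrite derivable1_diffP => /differentiable_continuous.
pose P u := f (u, y) * T u.
have dP t : is_derive t (1 : R) P (f (t, y) * T' t + f' (t, y) * T t).
  have := is_deriveM (df y t) (dT t).
  by rewrite /GRing.scale/= [T t * _]mulrC.
have cP : continuous P by move=> t; apply: cvgM; [exact: cf|exact: cT].
under eq_integral do rewrite slabE.
rewrite -[RHS](@continuous_FTC2 R (fun u => f (u, y) * T' u + f' (u, y) * T u) P a b)//.
- rewrite [RHS]integral_mkcond; apply: eq_integral => t _.
  by rewrite !patchE; case: ifPn.
- apply: continuous_subspaceT => t.
  by apply: cvgD; apply: cvgM; [exact: cf|exact: cT'|exact: cf'|exact: cT].
- split.
  + by move=> t _; have [] := dP t.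
  + exact: cvg_at_right_filter (cP _).
  + exact: cvg_at_left_filter (cP _).
- by move=> t _; rewrite derive1E; have [_] := dP t.
Qed.

(** Almost every section is integrable, and any two sections differ by the
integral of [f'] between them, which is integrable by Fubini. *)
Lemma integrable_section t : m.-integrable setT (fun y => (f (t, y))%:E).
Proof.
have [r ri] : exists r, m.-integrable setT (fun y => (f (r, y))%:E).
  have leb_gt0 : (0 < leb [set: measurableTypeR R])%E.
    by rewrite -set_itvNyy lebesgue_measure_itv/= lt0y.
  apply: (@filter_ex _ _ (ae_properfilter_algebraOfSetsType leb_gt0)).
  exact: ae_integrable1 fi.
have Di a b : a < b -> m.-integrable setT (fun y => (f (b, y) - f (a, y))%:E).
  move=> ab; have d1 (u : R) : is_derive u (1 : R) (cst 1 : R -> R) (cst 0 u).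
    exact: is_derive_cst.
  have Ki := @slabi (cst 1) (cst 0) a b (@cst_continuous _ _ _) (@cst_continuous _ _ _).
  apply: eq_integrable (integrable_fubini_G Ki) => // y _.
  by rewrite (slab_line _ ab d1 (@cst_continuous _ _ _)) !mulr1.
have [rt|tr|<-//] := ltgtP r t.
  have := integrableD measurableT (Di _ _ rt) ri.
  apply: eq_integrable => // y _ /=.
  by rewrite -EFinD subrK.
have := integrableB measurableT ri (Di _ _ tr).
apply: eq_integrable => // y _ /=.
by rewrite -EFinB subKr.
Qed.

Let F t := \int[m]_y f (t, y).
Let F' t := \int[m]_y f' (t, y).

Lemma marginal_integration_by_parts (T T' : R -> R) a b : a < b ->
  (forall t, is_derive t (1 : R) T (T' t)) -> continuous T' ->
  leb.-integrable `[a, b] (EFin \o (fun t => F t * T' t + F' t * T t)) /\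
  \int[leb]_(t in `[a, b]) (F t * T' t + F' t * T t) = F b * T b - F a * T a.
Proof.
move=> ab dT cT'.
have cT : continuous T.
  by move=> t; have [+ _] := dT t; rewrite derivable1_diffP => /differentiable_continuous.
have Ki := slabi a b cT cT'.
have KF : ae_eq leb setT (fun t => \int[m]_y (slab T T' a b (t, y))%:E)%E
    (EFin \o ((fun t => F t * T' t + F' t * T t) \_ `[a, b])).
  apply: (@filterS _ _ (ae_filter_ringOfSetsType leb) _ _ _ (ae_integrable1 f'i)).
  move=> t f't _.
  under eq_integral do rewrite slabE patchE.
  rewrite /= patchE; case: ifPn => _; last by rewrite integral0.
  have ft := integrable_section t.
  have i1 := integrableZr measurableT (T' t) ft.
  have i2 := integrableZr measurableT (T t) f't.
  by rewrite /F /F' -!RintegralZr// -RintegralD// /Rintegral fineK//;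
    apply: integrable_fin_num => //; exact: (integrableD measurableT i1 i2).
have KFi : leb.-integrable setT (EFin \o ((fun t => F t * T' t + F' t * T t) \_ `[a, b])).
  apply: integrable_ae_eq KF (integrable_fubini_F Ki).
  have mF g : (leb \x m)%E.-integrable setT (EFin \o g) ->
      measurable_fun setT (fun t => \int[m]_y g (t, y)).
    move=> gi; apply: measurableT_comp; first exact: fine_measurable.
    exact: measurable_fubini_F gi.
  apply/measurable_EFinP; apply/(measurable_restrictT _ _).1 => //.
  apply: measurable_funTS; apply: measurable_funD; apply: measurable_funM;
    by [exact: mF | exact: continuous_measurable_fun].
have KFE : (\int[leb]_t (((fun t => F t * T' t + F' t * T t) \_ `[a, b]) t)%:E =
   (F b * T b - F a * T a)%:E)%E.
  have <- := ae_eq_integral _ _ measurableT (measurable_fubini_F Ki)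
    (measurable_int _ KFi) KF.
  rewrite (Fubini Ki).
  under eq_integral do rewrite (slab_line _ ab dT cT').
  have fb := integrable_section b; have fa := integrable_section a.
  have i1 := integrableZr measurableT (T b) fb.
  have i2 := integrableZr measurableT (T a) fa.
  by rewrite /F -!RintegralZr// -RintegralB// /Rintegral fineK//;
    apply: integrable_fin_num => //; exact: (integrableB measurableT i1 i2).
split.
  by apply/integrable_mkcond => //; rewrite restrict_EFin.
by rewrite /Rintegral integral_mkcond restrict_EFin KFE.
Qed.

End marginal_parts.

(** * Coordinate lines and cubes *)

Section rVcons_lines.
Context {R : realType} {n : nat}.
Implicit Types (t u : R) (y : 'rV[R]_n).

Lemma rVcons_ord0 t y : rVcons (t, y) 0 ord0 = t.
Proof. by rewrite mxE unlift_none. Qed.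

Lemma rVcons_lift t y (i : 'I_n) : rVcons (t, y) 0 (lift ord0 i) = y 0 i.
Proof. by rewrite mxE liftK. Qed.

Lemma continuous_rVcons_head y : continuous (fun t => rVcons (t, y)).
Proof.
move=> t; apply: cvg_row => i; rewrite mxE.
case: (unliftP ord0 i) => [j ->|->].
  under eq_fun do rewrite rVcons_lift.
  exact: cvg_cst.
under eq_fun do rewrite rVcons_ord0.
exact: cvg_id.
Qed.

Lemma continuous_rVcons_tail t : continuous (fun y => rVcons (t, y)).
Proof.
move=> y; apply: (cvg_row (F := nbhs y)) => i; rewrite mxE.
case: (unliftP ord0 i) => [j ->|->].
  under eq_fun do rewrite rVcons_lift.
  exact: coord_continuous.
under eq_fun do rewrite rVcons_ord0.
exact: cvg_cst.
Qed.

Lemma rVcons_head_line t y : rVcons (t, y) = rVcons (0, y) + t *: delta_mx 0 ord0.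
Proof.
apply/rowP => i; rewrite [in RHS]mxE [in X in _ + X]mxE.
case: (unliftP ord0 i) => [j ->|->].
  by rewrite !rVcons_lift mxE/= mulr0 addr0.
by rewrite !rVcons_ord0 mxE !eqxx mulr1 add0r.
Qed.

Lemma rVcons_tail_line t y u (i : 'I_n) :
  rVcons (t, y + u *: delta_mx 0 i) =
  rVcons (t, y) + u *: delta_mx 0 (lift ord0 i).
Proof.
apply/rowP => j; rewrite [in RHS]mxE.
case: (unliftP ord0 j) => [k ->|->].
  by rewrite !rVcons_lift !mxE /= (inj_eq lift_inj).
by rewrite !rVcons_ord0 !mxE/= mulr0 addr0.
Qed.

End rVcons_lines.

Definition box {R : realType} (n : nat) (M : R) : set 'rV[R]_n :=
  [set z | forall i, - M <= z 0 i <= M].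
Arguments box {R} n M.

Section box.
Context {R : realType}.

Lemma lebesgue_box n (M : R) : 0 <= M ->
  lebesgue_rV n (box n M) = ((M + M) ^+ n)%:E.
Proof.
move=> M0; pose I (i : 'I_n) : set (measurableTypeR R) := `[- M, M]%classic.
have -> : box n M = [set x | forall i, I i (x 0 i)].
  by apply/seteqP; split=> x xM i; have := xM i; rewrite /I /= in_itv.
rewrite lebesgue_rV_rectangle; last by move=> i; exact: measurable_itv.
rewrite (eq_bigr (fun=> (M + M)%:E)); last first.
  move=> i _; rewrite lebesgue_measure_itv/= lte_fin.
  case: ifPn; first by rewrite -EFinD opprK.
  by rewrite -leNgt => MM; congr EFin; lra.
by rewrite prodEFin big_const_ord iter_mulr_1.
Qed.

Lemma measurable_box n (M : R) : measurable (box n M).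
Proof.
rewrite (_ : box n M = \bigcap_(i in [set: 'I_n])
    ((fun x : 'rV[R]_n => x 0 i) @^-1` `[- M, M])).
  apply: fin_bigcap_measurable => // i _.
  by rewrite -[X in measurable X]setTI; exact: measurable_coord.
by apply/seteqP; split=> x xM i => [_|]; have := xM i; rewrite /= in_itv/=; apply.
Qed.

Lemma integrable_box n (v : 'rV[R]_n -> R) (M : R) : 0 <= M ->
  continuous v -> (forall z, 0 < v z <= 1) ->
  (lebesgue_rV n).-integrable (box n M) (EFin \o v).
Proof.
move=> M0 cv v01; apply: measurable_bounded_integrable.
- exact: measurable_box.
- by apply: le_lt_trans (ltry ((M + M) ^+ n)); rewrite -(lebesgue_box n M0).
- by apply: measurable_funTS; exact: continuous_measurable_rV.
- exists 1; split=> // x x1 z _ /=.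
  by have /andP[v0 v1] := v01 z; rewrite gtr0_norm// (le_trans v1)// ltW.
Qed.

Lemma Rintegral_box_gt0 n (v : 'rV[R]_n -> R) (M : R) : 0 < M ->
  continuous v -> (forall z, 0 < v z <= 1) ->
  0 < \int[lebesgue_rV n]_(z in box n M) v z.
Proof.
move=> M0 cv v01; apply: Rintegral_gt0.
- exact: measurable_box.
- apply: (@lt_le_trans _ _ ((M + M) ^+ n)%:E).
    by rewrite lte_fin exprn_gt0// addr_gt0.
  by rewrite -(lebesgue_box n (ltW M0)).
- exact: integrable_box (ltW M0) cv v01.
- by move=> z _; have /andP[] := v01 z.
Qed.

Section box_marginal.
Context {n : nat} (v : 'rV[R]_n.+1 -> R) (M : R).
Hypotheses (M_gt0 : 0 < M) (cv : continuous v) (v01 : forall z, 0 < v z <= 1).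
Let w t := \int[lebesgue_rV n]_(y in box n M) v (rVcons (t, y)).

Lemma continuous_rVcons_section t : continuous (fun y => v (rVcons (t, y))).
Proof.
by move=> y; apply: continuous_comp; [exact: continuous_rVcons_tail|exact: cv].
Qed.

Lemma continuous_box_marginal : continuous w.
Proof.
move=> t.
have iv (s : R) : (lebesgue_rV n).-integrable (box n M)
    (EFin \o (fun y => v (rVcons (s, y)))).
  exact: (integrable_box (ltW M_gt0) (@continuous_rVcons_section s) (fun=> v01 _)).
suff : {in (`]t - 1, t + 1[%classic : set R), continuous w}.
  by apply; rewrite inE/= in_itv/=; lra.
apply: (@continuity_under_integral R _ _ (lebesgue_rV n)
  (fun s y => v (rVcons (s, y))) (box n M) (@measurable_box n M) (t - 1) (t + 1)
   (fun s _ => iv s) _ (cst 1)).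
- apply: aeW => y _ s _.
  by apply: continuous_comp; [exact: continuous_rVcons_head|exact: cv].
- apply: (integrable_box (v := cst 1) (ltW M_gt0)) => [|z].
    exact: cst_continuous.
  by rewrite ltr01 lexx.
- move=> s _; apply: aeW => y _.
  by have /andP[v0 v1] := v01 (rVcons (s, y)); rewrite gtr0_norm.
Qed.

Lemma Rintegral_box_rVcons :
  \int[lebesgue_rV n.+1]_(z in box n.+1 M) v z = \int[leb]_(t in `[- M, M]) w t.
Proof.
have iv := integrable_box (ltW M_gt0) cv v01.
rewrite [LHS]Rintegral_mkcond [RHS]Rintegral_mkcond; congr fine.
rewrite integral_rVcons; last first.
  by have /(integrable_mkcond _ (@measurable_box _ M)).1 := iv; rewrite restrict_EFin.
apply: eq_integral => t _; rewrite [in RHS]patchE.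
have memE y : (rVcons (t, y) \in box n.+1 M) =
    (t \in `[- M, M]%classic) && (y \in box n M).
  apply/idP/andP => [/set_mem bx|[/set_mem + /set_mem bx]].
    split; apply/mem_set.
      by have := bx ord0; rewrite rVcons_ord0 /= in_itv.
    by move=> j; have := bx (lift ord0 j); rewrite rVcons_lift.
  rewrite /= in_itv/= => tM; apply/mem_set => j.
  by case: (unliftP ord0 j) => [k ->|->]; rewrite ?rVcons_lift ?rVcons_ord0.
under eq_integral do rewrite patchE memE.
case: ifPn => [_|_] /=; last by rewrite integral0.
rewrite /w fineK; last first.
  apply: integrable_fin_num; first exact: measurable_box.
  apply: (integrable_box (ltW M_gt0)) => //.
  exact: continuous_rVcons_section.
by rewrite [RHS]integral_mkcond; apply: eq_integral => y _; rewrite patchE; case: ifPn.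
Qed.

End box_marginal.
End box.

(** * The inequality in all dimensions *)

(** Derivatives are required along coordinate lines only: this property is
inherited by the sections of [f], and it makes [f] a primitive of [D i] along
the lines over which Fubini integrates. *)
Definition coordinatewise_C1 {R : realType} {n : nat} (f : 'rV[R]_n -> R)
    (D : 'I_n -> 'rV[R]_n -> R) :=
  forall x i,
    (forall t, is_derive t (1 : R) (fun u => f (x + u *: delta_mx 0 i))
       (D i (x + t *: delta_mx 0 i))) /\
    continuous (fun t : R => D i (x + t *: delta_mx 0 i)).

(** Both sides of the pointwise hypothesis behave well under marginals: the
integral over the last [n] coordinates of [h + s z1 D0] is bounded below by the
induction hypothesis, and subtracting [n F (1 + ln s)] leaves exactly the
hypothesis of the one-dimensional inequality for the marginals.  The entropy
[f ln f] is hidden in [h], so no integrability of [F ln F] for the marginal [F]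
has to be proved.  The function [h] takes extended real values since a Legendre
transform will enter it. *)
Lemma dual_entropy_inequality (R : realType) (M s : R) (M_gt0 : 0 < M)
    (s_gt0 : 0 < s) (n : nat) (f v : 'rV[R]_n -> R)
    (D : 'I_n -> 'rV[R]_n -> R) (h : 'rV[R]_n -> \bar R)
    (A := \int[lebesgue_rV n]_(z in box n M) v z)
    (I := \int[lebesgue_rV n]_x f x) :
  (forall x, 0 <= f x) -> coordinatewise_C1 f D ->
  (lebesgue_rV n).-integrable setT (EFin \o f) ->
  (forall i, (lebesgue_rV n).-integrable setT (EFin \o D i)) ->
  (lebesgue_rV n).-integrable setT h ->
  continuous v -> (forall z, 0 < v z <= 1) ->
  (forall x z, box n M z ->
    ((f x * ln (v z / f x) - s * \sum_i z 0 i * D i x)%:E <= h x)%E) ->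
  I * ln (A / I) + n%:R * I * (1 + ln s) <=
    fine (\int[lebesgue_rV n]_x h x).
Proof.
elim: n => [|n IHn] in f v D h A I *.
  move=> f0 _ fi _ hi cv v01 fvh.
  have IE : I = f 0.
    rewrite /I /Rintegral /= integral_dirac//; last exact: measurable_int fi.
    by rewrite diracT mul1e.
  have AE : A = v 0.
    rewrite /A /Rintegral /= integral_dirac//; last 2 first.
      exact: measurable_box.
      by apply: measurable_funTS; apply/measurable_EFinP; exact: continuous_measurable_rV.
    by rewrite diracE mem_set ?mul1e//; case.
  rewrite mul0r mul0r addr0 IE AE.
  have hE : (\int[lebesgue_rV 0]_x h x = h 0%R)%E.
    rewrite /= integral_dirac//; last exact: measurable_int hi.
    by rewrite diracT mul1e.
  have hfin : h 0 \is a fin_num by rewrite -hE; exact: integrable_fin_num.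
  rewrite hE -lee_fin fineK//.
  have /(fvh 0) : box 0 M (0 : 'rV[R]_0) by case.
  by rewrite big_ord0 mulr0 subr0.
move=> f0 fD fi Di hi cv v01 fvh.
pose F t := \int[lebesgue_rV n]_y f (rVcons (t, y)).
pose phi t := \int[lebesgue_rV n]_y D ord0 (rVcons (t, y)).
pose w t := \int[lebesgue_rV n]_(y in box n M) v (rVcons (t, y)).
pose K t := (\int[lebesgue_rV n]_y h (rVcons (t, y)))%E.
(* [n%:R * (1 + ln s) * F t] is what the induction hypothesis contributes *)
pose H t := fine (K t) - n%:R * (1 + ln s) * F t.
have fic := integrable_rVcons fi.
have Dic i := integrable_rVcons (Di i).
have hic := integrable_rVcons hi.
have df y t : is_derive t (1 : R) (fun u => f (rVcons (u, y))) (D ord0 (rVcons (t, y))).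
  under eq_fun do rewrite (rVcons_head_line _ y).
  rewrite (rVcons_head_line t y); exact: (fD (rVcons (0, y)) ord0).1.
have cD y : continuous (fun t => D ord0 (rVcons (t, y))).
  under eq_fun do rewrite (rVcons_head_line _ y).
  exact: (fD (rVcons (0, y)) ord0).2.
have Ft t : (lebesgue_rV n).-integrable setT (fun y => (f (rVcons (t, y)))%:E).
  exact: (integrable_section fic (Dic ord0) df cD).
have parts T T' (dT : forall t, is_derive t (1 : R) T (T' t)) cT' a b ab :=
  marginal_integration_by_parts fic (Dic ord0) df cD ab dT cT'.
have [iF IF] := integrable_fine (integrable_fubini_F fic).
have [iphi _] := integrable_fine (integrable_fubini_F (Dic ord0)).
have [iK IK] := integrable_fine (integrable_fubini_F hic).
have iH : leb.-integrable setT (EFin \o H).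
  exact: (integrableB measurableT iK (integrableZl measurableT _ iF)).
have -> : I = \int[leb]_t F t.
  by rewrite /I /Rintegral integral_rVcons// -IF.
have -> : A = \int[leb]_(t in `[- M, M]) w t by exact: Rintegral_box_rVcons.
have HE : \int[leb]_t H t =
    fine (\int[lebesgue_rV n.+1]_x h x)%E - n%:R * (1 + ln s) * \int[leb]_t F t.
  rewrite RintegralB//; last exact: (integrableZl measurableT _ iF).
  by rewrite RintegralZl// integral_rVcons// -IK.
suff : (\int[leb]_t F t) *
    ln (\int[leb]_(t in `[- M, M]) w t / \int[leb]_t F t) +
    \int[leb]_t F t + (\int[leb]_t F t) * ln s <=
    \int[leb]_t H t.
  rewrite HE lerBrDr -natr1; apply: le_trans.
  by rewrite le_eqVlt; apply/orP; left; apply/eqP; ring.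
apply: (transport_inequality_1d (phi := phi)) => //.
- exact: continuous_box_marginal.
- by move=> z; apply: Rintegral_box_gt0 => //; exact: continuous_rVcons_section.
- by move=> t; exact: Rintegral_ge0.
- by move=> T T' dT cT' a b ab; exact: parts.
have aeD : {ae leb, forall t i,
    (lebesgue_rV n).-integrable setT (fun y => (D i (rVcons (t, y)))%:E)}.
  apply: (@filter_forall _ _ _ _ (ae_filter_ringOfSetsType _)) => i.
  exact: ae_integrable1 (Dic i).
have aeh : {ae leb, forall t,
    (lebesgue_rV n).-integrable setT (fun y => h (rVcons (t, y)))}.
  exact: (ae_integrable1 hic).
apply: (@filterS2 _ _ (ae_filter_ringOfSetsType leb) _ _ _ _ aeD aeh).
move=> t Dt ht z zM.
pose ht' y := (h (rVcons (t, y)) + (s * z * D ord0 (rVcons (t, y)))%:E)%E.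
have iD0 : (lebesgue_rV n).-integrable setT (fun y => (s * z * D ord0 (rVcons (t, y)))%:E).
  exact: (integrableZl measurableT (s * z) (Dt ord0)).
have := @IHn (fun y => f (rVcons (t, y))) (fun y => v (rVcons (z, y)))
  (fun i y => D (lift ord0 i) (rVcons (t, y))) ht' (fun=> f0 _) _ (Ft t)
  (fun i => Dt (lift ord0 i)) (integrableD measurableT ht iD0)
  (continuous_rVcons_section (t := z) cv) (fun=> v01 _) _.
rewrite -/(F t) -/(w z).
have -> : fine (\int[lebesgue_rV n]_y ht' y)%E = fine (K t) + s * (z * phi t).
  rewrite /ht' integralD// fineD; last 2 first.
  - exact: integrable_fin_num.
  - exact: integrable_fin_num.
  by rewrite mulrA /phi -RintegralZl//; exact: Dt.
move=> Ht; rewrite lerBlDr /H.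
apply: (@le_trans _ _ (fine (K t) + s * (z * phi t) - n%:R * F t * (1 + ln s))); last first.
  by rewrite le_eqVlt; apply/orP; left; apply/eqP; ring.
rewrite lerBrDr; apply: Ht.
  move=> y i; split=> [u|].
    under eq_fun do rewrite rVcons_tail_line.
    rewrite rVcons_tail_line; exact: (fD _ _).1.
  under eq_fun do rewrite rVcons_tail_line.
  exact: (fD _ _).2.
move=> y z' z'M.
have := fvh (rVcons (t, y)) (rVcons (z, z')).
rewrite big_ord_recl rVcons_ord0.
under eq_bigr do rewrite rVcons_lift.
move=> zh.
have -> : f (rVcons (t, y)) * ln (v (rVcons (z, z')) / f (rVcons (t, y))) -
    s * \sum_i z' 0 i * D (lift ord0 i) (rVcons (t, y)) =
  (f (rVcons (t, y)) * ln (v (rVcons (z, z')) / f (rVcons (t, y))) -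
    s * (z * D ord0 (rVcons (t, y)) +
     \sum_i z' 0 i * D (lift ord0 i) (rVcons (t, y)))) + s * z * D ord0 (rVcons (t, y)).
  by ring.
rewrite EFinD leeD2r//; apply: zh => i.
by case: (unliftP ord0 i) => [j ->|->]; rewrite ?rVcons_lift ?rVcons_ord0.
Qed.

(** * Homogeneous strictly convex functions *)

Section homogeneous_convex.
Context {R : realType} {n : nat} (q : R) (C : 'rV[R]_n -> R).
Hypotheses (n_gt0 : (0 < n)%N) (C_convex : strictly_convex C)
  (C_homogeneous : homogeneous q C).

Let e1 : 'rV[R]_n := delta_mx 0 (Ordinal n_gt0).

Let e1_neq0 : e1 != 0.
Proof.
by apply/eqP => /rowP /(_ (Ordinal n_gt0)) /eqP; rewrite !mxE !eqxx oner_eq0.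
Qed.

Let half01 : 0 < (2^-1 : R) < 1. Proof. lra. Qed.

Let q_neq0 : q != 0.
Proof.
apply/eqP => q0.
have CE x : C x = C 0.
  by have := C_homogeneous x (lexx 0); rewrite scale0r q0 powRr0 mul1r.
by have := C_convex e1_neq0 half01; rewrite !CE; lra.
Qed.

Lemma homogeneous0 : C 0 = 0.
Proof.
by have := C_homogeneous 0 (lexx 0); rewrite scale0r powR0// mul0r.
Qed.

Let C_half x : x != 0 -> 2^-1 `^ q * C x < 2^-1 * C x.
Proof.
move=> x0; have := C_convex x0 half01.
by rewrite scaler0 addr0 homogeneous0 mulr0 addr0 C_homogeneous ?invr_ge0.
Qed.

(** Strict convexity at [e1] and [- e1] makes [C] positive somewhere, and there
[C (x / 2) < C x / 2] forces [2^-q < 1/2]. *)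
Lemma homogeneous_convex_gt1 : 1 < q.
Proof.
have [x x0 Cx] : exists2 x, x != 0 & 0 < C x.
  have e1N : e1 != - e1.
    by rewrite -subr_eq0 opprK -mulr2n -scaler_nat scaler_eq0 negb_or pnatr_eq0 e1_neq0.
  have := C_convex e1N half01.
  rewrite (_ : _ + _ = 0) ?homogeneous0; last first.
    by rewrite scalerN (_ : 1 - 2^-1 = 2^-1) ?subrr//; lra.
  have [Ce|Ce] := ltP 0 (C e1); first by exists e1.
  move=> h; exists (- e1); [by rewrite oppr_eq0|by move: h Ce; lra].
have := C_half x0; rewrite ltr_pM2r// -ltr_ln ?posrE ?powR_gt0 ?invr_gt0//.
rewrite ln_powR.
have : ln (2^-1) < 0 :> R by rewrite ln_lt0//; exact: half01.
nra.
Qed.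

Lemma homogeneous_convex_ge0 x : 0 <= C x.
Proof.
have [->|x0] := eqVneq x 0; first by rewrite homogeneous0.
have := C_half x0.
have : 2^-1 `^ q < 2^-1 :> R.
  rewrite -ltr_ln ?posrE ?powR_gt0 ?invr_gt0// ln_powR.
  have : ln (2^-1) < 0 :> R by rewrite ln_lt0//; exact: half01.
  by have := homogeneous_convex_gt1; nra.
nra.
Qed.

Let C_ge0 := homogeneous_convex_ge0.

Let convex_le x y t : 0 < t < 1 -> C (t *: x + (1 - t) *: y) <= t * C x + (1 - t) * C y.
Proof.
move=> t01; have [->|xy] := eqVneq x y; last exact/ltW/C_convex.
by rewrite -scalerDl -mulrDl subrKC scale1r mul1r.
Qed.

Let C_add x y : C (x + y) <= 2 `^ q * (C x + C y).
Proof.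
have := @convex_le (2 *: x) (2 *: y) 2^-1 half01.
rewrite (_ : 1 - 2^-1 = 2^-1); last by lra.
rewrite !scalerA mulVf ?pnatr_eq0// !scale1r => /le_trans; apply.
rewrite !C_homogeneous// -mulrDr -mulrDr ler_piMl ?mulr_ge0 ?powR_ge0 ?addr_ge0//.
lra.
Qed.

(** [C_add] reduces the bound on the cube to the coordinate axes. *)
Let C_unit_cube : exists2 B, 0 <= B &
  forall x : 'rV[R]_n, (forall i, `|x 0 i| <= 1) -> C x <= B.
Proof.
suff [B B0 CB] : exists2 B, 0 <= B & forall x : 'rV[R]_n, (forall i, `|x 0 i| <= 1) ->
    C (\sum_(i <- index_enum 'I_n) x 0 i *: delta_mx 0 i) <= B.
  by exists B => // x x1; rewrite [x]row_sum_delta; exact: CB.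
elim: (index_enum _) => [|i r [B B0 CB]].
  by exists 0 => // x _; rewrite big_nil homogeneous0.
pose ei : 'rV[R]_n := delta_mx 0 i.
exists (2 `^ q * (C ei + C (- ei) + B)).
  by rewrite mulr_ge0 ?powR_ge0 ?addr_ge0.
move=> x x1; rewrite big_cons; apply: le_trans (C_add _ _) _.
rewrite ler_pM2l ?powR_gt0// lerD ?CB//.
have xq : `|x 0 i| `^ q <= 1.
  rewrite [leRHS](_ : 1 = 1 `^ q); last by rewrite powR1.
  apply: ge0_ler_powR; rewrite ?nnegrE//.
  exact: ltW (lt_trans ltr01 homogeneous_convex_gt1).
have [x0|x0] := leP 0 (x 0 i).
  rewrite C_homogeneous// -[X in X `^ _]ger0_norm//.
  by rewrite -[leLHS]addr0 lerD// ler_piMl.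
rewrite -[x 0 i]opprK scaleNr -scalerN -ltr0_norm// C_homogeneous//.
by rewrite -[leLHS]add0r lerD// ler_piMl.
Qed.

(** Each of two points [a], [b] at distance at most [t] from each other is a
convex combination, with weights [1 - t] and [t], of the other one and of a
point that stays in a fixed cube; as [C] is bounded by [K] there, convexity
gives [C b <= C a + t K]. *)
Lemma homogeneous_convex_continuous : continuous C.
Proof.
have [B B0 CB] := C_unit_cube.
move=> x; pose r : R := 2 + \sum_i `|x 0 i|.
have r0 : 0 < r by rewrite ltr_pwDl// sumr_ge0.
have xr i : `|x 0 i| + 2 <= r.
  by rewrite addrC lerD2l (bigD1 i)//= lerDl sumr_ge0.
pose K := r `^ q * B.
have K0 : 0 <= K by rewrite mulr_ge0 ?powR_ge0.
have CK (z : 'rV[R]_n) : (forall i, `|z 0 i| <= r) -> C z <= K.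
  move=> zr; rewrite -[z](scalerKV (lt0r_neq0 r0)) (C_homogeneous _ (ltW r0)).
  rewrite /K ler_pM2l ?powR_gt0//; apply: CB => i.
  by rewrite mxE normrM gtr0_norm ?invr_gt0// mulrC ler_pdivrMr// mul1r.
have step (y : 'rV[R]_n) t : 0 < t < 1 -> (forall i, `|y 0 i - x 0 i| <= t) ->
    C y <= C x + t * K /\ C x <= C y + t * K.
  move=> /andP[t0 t1] xy.
  have tE (a b : 'rV[R]_n) : b = t *: (a + t^-1 *: (b - a)) + (1 - t) *: a.
    rewrite scalerDr scalerA divff ?gt_eqF// scale1r scalerBl scale1r.
    by rewrite -addrA [b - a + _]addrA subrK addrC subrK.
  have bound (a b : 'rV[R]_n) : (forall i, `|a 0 i| <= `|x 0 i| + 1) ->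
      (forall i, `|b 0 i - a 0 i| <= t) ->
      C b <= C a + t * K.
    move=> ax ab; rewrite [in leLHS](tE a b).
    apply: le_trans (convex_le _ _ _) _; first by rewrite t0.
    rewrite addrC lerD//.
      by rewrite ler_piMl// lerBlDr lerDl ltW.
    rewrite ler_pM2l//; apply: CK => i; rewrite !mxE.
    apply: le_trans (ler_normD _ _) _.
    rewrite normrM gtr0_norm ?invr_gt0//.
    have : t^-1 * `|b 0 i - a 0 i| <= 1 by rewrite mulrC ler_pdivrMr// mul1r.
    by have := ax i; have := xr i; lra.
  split; apply: bound => // i.
  - by rewrite lerDl.
  - rewrite -[y 0 i](subrK (x 0 i)); apply: le_trans (ler_normD _ _) _.
    by have := xy i; lra.
  - by rewrite distrC.
suff : C y @[y --> nbhs x] --> C x by [].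
apply/(@cvgrPdist_le _ _ _ (nbhs x)) => e e0.
have t01 : 0 < Num.min 2^-1 (e / (K + 1)) < 1.
  by have /andP[h0 h1] := half01; rewrite lt_min gt_min h0 h1 divr_gt0 ?ltr_wpDl.
set t := Num.min _ _ in t01.
have tK : t * K <= e.
  have K1 : 0 < K + 1 by rewrite ltr_wpDl.
  apply: (@le_trans _ _ (e / (K + 1) * (K + 1))); last by rewrite divfK// gt_eqF.
  by rewrite ler_pM// ?lerDl// ?ge_min ?lexx ?orbT//; case/andP: t01 => /ltW.
have : nbhs x (ball x t) by apply: nbhsx_ballx; case/andP: t01.
apply: filterS => y [_ xy].
have [] := step y t t01.
  by move=> i; rewrite distrC; exact/ltW/xy.
by move=> Cy Cx; rewrite ler_distl; lra.
Qed.

End homogeneous_convex.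

(** * The Legendre transform *)

Section legendre.
Context {R : realType} {n : nat}.
Implicit Types (C : 'rV[R]_n -> R) (y z : 'rV[R]_n).

Lemma legendre_ge C y z : ((dotp y z - C z)%:E <= legendre C y)%E.
Proof. by apply: ereal_sup_ubound; exists z. Qed.

Lemma dotpZr y z (a : R) : dotp y (a *: z) = a * dotp y z.
Proof. by rewrite /dotp mulr_sumr; apply: eq_bigr => i _; rewrite mxE mulrCA. Qed.

Lemma dotp_delta y (i : 'I_n) : dotp y (delta_mx 0 i) = y 0 i.
Proof.
rewrite /dotp (bigD1 i)//= mxE !eqxx mulr1 big1 ?addr0// => j ji.
by rewrite mxE (negbTE ji) andbF mulr0.
Qed.

Lemma legendre_ge0 C y : C 0 = 0 -> (0 <= legendre C y)%E.
Proof.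
move=> C0; have := legendre_ge C y 0.
by rewrite C0 subr0 -[X in dotp _ X](scale0r 0) dotpZr mul0r.
Qed.

(** Testing the supremum at the basis vectors and their opposites; this is how
the integrability of [legendre C (- grad g) * exp g] controls [grad g]. *)
Lemma coord_le_legendre C y (i : 'I_n) : (forall z, 0 <= C z) ->
  ((`|y 0 i|)%:E <= legendre C y + (C (delta_mx 0 i) + C (- delta_mx 0 i))%:E)%E.
Proof.
move=> C0; have := legendre_ge C y (delta_mx 0 i).
have := legendre_ge C y (- delta_mx 0 i).
rewrite -scaleN1r dotpZr dotp_delta mulN1r.
case: (legendre C y) => [l||]//=; last by rewrite !leey.
rewrite scaleN1r !lee_fin => h1 h2.
have := C0 (delta_mx 0 i); have := C0 (- delta_mx 0 i).
by case: (leP 0 (y 0 i)) => y0; [rewrite ger0_norm//|rewrite ltr0_norm//]; lra.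
Qed.

(** The Fenchel inequality for [s y], up to the [p]-homogeneity of the transform:
it is the definition of the supremum at the point [s `^ (1 - p) *: z], since
[p + (1 - p) q = 0]. *)
Lemma legendre_scale C (p q s : R) y z : homogeneous q C ->
  p - (p - 1) * q = 0 -> 0 < s ->
  ((s * dotp y z - C z)%:E <= (s `^ p)%:E * legendre C y)%E.
Proof.
move=> hC pq s0.
have -> : s * dotp y z - C z =
    s `^ p * (dotp y (s `^ (1 - p) *: z) - C (s `^ (1 - p) *: z)).
  rewrite dotpZr hC ?powR_ge0// mulrBr !mulrA -powRD; last by rewrite (gt_eqF s0) implybT.
  rewrite subrKC powRr1 ?ltW// -powRrM -powRD; last by rewrite (gt_eqF s0) implybT.
  by rewrite (_ : p + (1 - p) * q = 0) ?powRr0 ?mul1r// -pq; ring.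
by rewrite EFinM lee_pmul2l// ?lte_fin ?powR_gt0//; exact: legendre_ge.
Qed.

End legendre.

(** * The exponential of a C^1 function *)

Section exponential_C1.
Context {R : realType} {n : nat} (g : 'rV[R]_n -> R).
Hypothesis g_C1 : continuously_differentiable g.

Let dg (i : 'I_n) x := expR (g x) * grad g x 0 i.

Lemma continuous_C1 : continuous g.
Proof. by move=> x; apply: differentiable_continuous; exact: g_C1.1. Qed.

Lemma continuous_expg_grad i : continuous (dg i).
Proof.
move=> x.
have cg := @continuous_C1 x.
have c1 := continuous_comp cg (@continuous_expR R (g x)).
have c2 := continuous_comp (@g_C1.2 x) (@coord_continuous _ 1 n 0 i (grad g x)).
exact: (cvgM c1 c2).
Qed.

Lemma coordinatewise_C1_expg : coordinatewise_C1 (fun x => expR (g x)) dg.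
Proof.
move=> x i; pose L (u : R) : 'rV[R]_n := x + u *: delta_mx 0 i.
have cL : continuous L.
  move=> u; apply: cvgD; first exact: cvg_cst.
  by apply: cvgZr_tmp; exact: cvg_id.
split=> [t|]; last first.
  move=> t; have := continuous_comp (cL t) (@continuous_expg_grad i (L t)).
  exact.
have dgL : is_derive t (1 : R) (g \o L) (grad g (L t) 0 i).
  (* both derivatives are limits of one and the same difference quotient *)
  have quotE : (fun h : R => h^-1 *: ((g \o L) (h *: (1 : R) + t) - (g \o L) t)) =
      (fun h => h^-1 *: (g (h *: delta_mx 0 i + L t) - g (L t))).
    by apply/funext => h; rewrite /= /L scalerDl addrCA /GRing.scale/= mulr1.
  have dgLt : derivable g (L t) (delta_mx 0 i).
    by apply: diff_derivable; exact: g_C1.1.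
  apply: DeriveDef; first by rewrite /derivable quotE.
  by rewrite /grad mxE /derive quotE.
have := is_derive1_comp (is_derive_expR (g (L t))) dgL.
exact.
Qed.

End exponential_C1.

(** * Optimal Euclidean logarithmic Sobolev inequality *)

Lemma lebesgue_rV_setT_gt0 (R : realType) (n : nat) :
  (0 < lebesgue_rV n [set: 'rV[R]_n])%E.
Proof.
apply: (@lt_le_trans _ _ (lebesgue_rV n (box n (1 : R)))).
  apply: (@lt_le_trans _ _ ((1 + 1) ^+ n)%:E); first by rewrite lte_fin exprn_gt0.
  by rewrite -(lebesgue_box n ler01).
by apply: le_measure; rewrite ?inE//; exact: measurable_box.
Qed.

(** Monotone convergence; the bound [b] also gives the integrability of [v] on
the whole space, without which its real-valued integral would be void. *)
Lemma Rintegral_le_box_bound (R : realType) (n : nat) (v : 'rV[R]_n -> R) (b : R) :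
  continuous v -> (forall z, 0 < v z <= 1) ->
  (forall M, 0 < M -> \int[lebesgue_rV n]_(z in box n M) v z <= b) ->
  0 < \int[lebesgue_rV n]_z v z <= b.
Proof.
move=> cv v01 vb.
have mv : measurable_fun setT (EFin \o v).
  by apply/measurable_EFinP; exact: continuous_measurable_rV.
have v0 z : (0 <= (v z)%:E)%E by rewrite lee_fin; have /andP[/ltW] := v01 z.
have boxE M : 0 < M -> (\int[lebesgue_rV n]_(z in box n M) (v z)%:E =
    (\int[lebesgue_rV n]_(z in box n M) v z)%:E)%E.
  move=> M0; rewrite /Rintegral fineK//; apply: integrable_fin_num.
    exact: measurable_box.
  exact: integrable_box (ltW M0) cv v01.
have lev : (\int[lebesgue_rV n]_z (v z)%:E <= b%:E)%E.
  have bigbox : \bigcup_k box n (k.+1%:R : R) = setT.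
    apply/seteqP; split=> // z _; exists (Num.bound (\sum_i `|z 0 i|)) => // i.
    rewrite -ler_norml; apply: (@le_trans _ _ (\sum_i `|z 0 i|)).
      by rewrite (bigD1 i)//= lerDl sumr_ge0.
    rewrite -natr1 -[leLHS]addr0 lerD// ltW// archi_boundP//.
    exact: sumr_ge0.
  pose F k : set 'rV[R]_n := box n k.+1%:R.
  have ndF : nondecreasing_seq F.
    move=> k l kl; apply/subsetPset => z zk i; have := zk i.
    have : k.+1%:R <= l.+1%:R :> R by rewrite ler_nat.
    lra.
  have mF k : measurable (F k) by exact: measurable_box.
  have mvF k : measurable_fun (F k) (EFin \o v) by exact: measurable_funTS.
  have cvgF := ge0_nondecreasing_set_cvg_integral (mu := lebesgue_rV n) ndF mF mvF
    (fun _ z _ => v0 z).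
  rewrite -bigbox -(cvg_lim _ cvgF)//; apply: lime_le; first exact: cvgP cvgF.
  by near=> k; rewrite boxE// lee_fin; exact: vb.
have lev1 : ((\int[lebesgue_rV n]_(z in box n 1) v z)%:E <= \int[lebesgue_rV n]_z (v z)%:E)%E.
  rewrite -boxE//; apply: ge0_subset_integral => //; exact: measurable_box.
have fin : (\int[lebesgue_rV n]_z (v z)%:E)%E \is a fin_num.
  by rewrite ge0_fin_numE ?integral_ge0// (le_lt_trans lev)// ltry.
apply/andP; split.
  apply: lt_le_trans (Rintegral_box_gt0 ltr01 cv v01) _.
  by rewrite -lee_fin [X in (_ <= X)%E]fineK.
by rewrite -lee_fin [X in (X <= _)%E]fineK.
Unshelve. all: by end_near.
Qed.

(** The right-hand side of the hypothesis minus its left-hand side is minimal at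
[s `^ p = N * I / (p * J)]. *)
Lemma minimize_dilation (R : realType) (N p I J L E : R) :
  0 < N -> 0 < p -> 0 < I -> 0 < J -> 0 < L ->
  (forall s, 0 < s -> E + I * ln L + N * I * (1 + ln s) <= s `^ p * J) ->
  E <= N / p * I * ln (p / (N * expR 1 `^ (p - 1) * L `^ (p / N)) * (J / I)).
Proof.
move=> N0 p0 I0 J0 L0 bound.
pose r := N * I / (p * J).
have r0 : 0 < r by rewrite divr_gt0// mulr_gt0.
have := bound (r `^ p^-1) (powR_gt0 _ r0).
rewrite -powRrM mulVf ?gt_eqF// powRr1 ?(ltW r0)// ln_powR => H.
have -> : ln (p / (N * expR 1 `^ (p - 1) * L `^ (p / N)) * (J / I)) =
    - ln r - (p - 1) - p / N * ln L.
  rewrite /r !(lnM, lnV) ?posrE ?invr_gt0 ?mulr_gt0 ?invr_gt0 ?mulr_gt0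
    ?powR_gt0 ?expR_gt0//.
  by rewrite !ln_powR expRK; ring.
rewrite -subr_ge0 in H; rewrite -subr_ge0; apply: le_trans H _.
rewrite le_eqVlt; apply/orP; left; apply/eqP.
have rJ : r * J = N * I / p by rewrite /r; field; rewrite !gt_eqF.
by rewrite rJ; field; rewrite !gt_eqF.
Qed.

Section optimal_log_sobolev.
Context {R : realType} {n : nat} (p q : R) (C g : 'rV[R]_n -> R)
  (n_gt0 : (0 < n)%N)
  (C_convex : strictly_convex C)
  (C_homogeneous : homogeneous q C)
  (pq : p^-1 + q^-1 = 1)
  (g_C1 : continuously_differentiable g)
  (int_expg : (lebesgue_rV n).-integrable setT (fun x => (expR (g x))%:E))
  (int_ent : (lebesgue_rV n).-integrable setT (fun x =>
       (expR (g x) *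
        ln (expR (g x) / \int[lebesgue_rV n]_y expR (g y)))%:E))
  (int_grad : (lebesgue_rV n).-integrable setT (fun x =>
       (legendre C (- grad g x) * (expR (g x))%:E)%E)).
Local Notation m := (lebesgue_rV n).
Let L := \int[m]_x expR (- C x).
Let I := \int[m]_x expR (g x).
Let J := fine (\int[m]_x (legendre C (- grad g x) * (expR (g x))%:E)%E).
Let f x := expR (g x).
Let E := Ent f.

Let q_gt1 : 1 < q. Proof. exact: homogeneous_convex_gt1 n_gt0 C_convex C_homogeneous. Qed.
Let C_ge0 x : 0 <= C x.
Proof. exact: (homogeneous_convex_ge0 n_gt0 C_convex C_homogeneous). Qed.
Let C0 : C 0 = 0. Proof. exact: (homogeneous0 n_gt0 C_convex C_homogeneous). Qed.
Let C_cont : continuous C.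
Proof. exact: (homogeneous_convex_continuous n_gt0 C_convex C_homogeneous). Qed.

Let p_neq0 : p != 0.
Proof.
apply/eqP => p0; move: pq; rewrite p0 invr0 add0r => /eqP; rewrite invr_eq1.
by move/eqP => q1; move: q_gt1; rewrite q1 ltxx.
Qed.

Let pqE : p + q = p * q.
Proof.
have q0 : q != 0 by rewrite gt_eqF// (lt_trans ltr01).
have -> : p + q = p * q * (p^-1 + q^-1) by field; rewrite p_neq0 q0.
by rewrite pq mulr1.
Qed.

Let p_gt1 : 1 < p.
Proof. have := pqE; have := q_gt1; nra. Qed.

Let I_gt0 : 0 < I.
Proof.
apply: Rintegral_gt0 => //; first exact: lebesgue_rV_setT_gt0.
by move=> x _; exact: expR_gt0.
Qed.

Let int_fg : m.-integrable setT (fun x => (f x * g x)%:E).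
Proof.
have := integrableD measurableT int_ent (integrableZl measurableT (ln I) int_expg).
apply: eq_integrable => // x _.
by rewrite -EFinM -EFinD ln_div ?posrE ?expR_gt0// expRK /f -/I; congr EFin; ring.
Qed.

Let EE : \int[m]_x (f x * g x) = E + ln I * I.
Proof.
rewrite /E /Ent -/I -RintegralZl// -RintegralD//; last first.
  exact: (integrableZl measurableT (ln I) int_expg).
apply: eq_Rintegral => x _.
by rewrite ln_div ?posrE ?expR_gt0// expRK /f; ring.
Qed.

Let v z := expR (- C z).

Let v01 z : 0 < v z <= 1.
Proof.
rewrite /v expR_gt0 /= -[leRHS]expR0 ler_expR oppr_le0; exact: C_ge0.
Qed.

Let cv : continuous v.
Proof.
move=> z; have cN := continuousN (@C_cont z).
exact: (continuous_comp cN (@continuous_expR R (- C z))).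
Qed.

Let D (i : 'I_n) x := expR (g x) * grad g x 0 i.

Let int_D i : m.-integrable setT (EFin \o D i).
Proof.
pose c := C (delta_mx 0 i) + C (- delta_mx 0 i).
have ic := integrableD measurableT int_grad (integrableZl measurableT c int_expg).
apply: le_integrable ic => //.
  apply/measurable_EFinP; apply: continuous_measurable_rV.
  exact: (@continuous_expg_grad _ _ _ g_C1 i).
move=> x _; apply: le_trans (lee_abs _).
have c_ge0 : (0 <= c%:E)%E by rewrite lee_fin addr_ge0.
rewrite -ge0_muleDl//; last exact: legendre_ge0.
rewrite /= normrM gtr0_norm ?expR_gt0// mulrC EFinM.
apply: lee_wpmul2r; first by rewrite lee_fin expR_ge0.
by have := coord_le_legendre (- grad g x) i C_ge0; rewrite mxE normrN.
Qed.

(** The inequality before optimization; [ln I] has been absorbed in the entropy. *)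
Let main_bound (s M : R) : 0 < s -> 0 < M ->
  E + I * ln (\int[m]_(z in box n M) v z) + n%:R * I * (1 + ln s) <= s `^ p * J.
Proof.
move=> s0 M0.
pose h x := ((s `^ p)%:E * (legendre C (- grad g x) * (f x)%:E) - (f x * g x)%:E)%E.
have ik := integrableZl measurableT (s `^ p) int_grad.
have ih : m.-integrable setT h := integrableB measurableT ik int_fg.
have := @dual_entropy_inequality R M s M0 s0 n f v D h (fun x => expR_ge0 (g x))
  (coordinatewise_C1_expg g_C1) int_expg int_D ih cv v01.
have -> : fine (\int[m]_x h x)%E = s `^ p * J - (E + ln I * I).
  rewrite integralB// fineB; [|exact: integrable_fin_num..].
  rewrite integralZl// fineM//; last exact: integrable_fin_num.
  by rewrite -EE.
rewrite -/I ln_div ?posrE ?Rintegral_box_gt0// => H.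
have {}H : I * (ln (\int[m]_(z in box n M) v z) - ln I) + n%:R * I * (1 + ln s) <=
    s `^ p * J - (E + ln I * I).
  apply: H => x z _; rewrite /h leeBrDr// -EFinD muleA.
  have -> : f x * ln (v z / f x) - s * (\sum_i z 0 i * D i x) + f x * g x =
      (s * dotp (- grad g x) z - C z) * f x.
    have -> : \sum_i z 0 i * D i x = - (dotp (- grad g x) z * f x).
      rewrite /dotp mulr_suml -sumrN; apply: eq_bigr => i _.
      by rewrite /D /f [(- grad g x) 0 i]mxE; ring.
    by rewrite ln_div ?posrE ?expR_gt0// !expRK; ring.
  rewrite EFinM; apply: lee_wpmul2r; first by rewrite lee_fin expR_ge0.
  apply: legendre_scale C_homogeneous _ s0.
  by rewrite mulrBl mul1r -pqE; ring.
rewrite -subr_ge0 in H; rewrite -subr_ge0; apply: le_trans H _.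
rewrite le_eqVlt; apply/orP; left; apply/eqP.
move: (ln (\int[_]_(z in _) _)) (ln I) (ln s) (s `^ p) (E) (J) (I) => *.
ring.
Qed.

Let nI_gt0 : 0 < n%:R * I.
Proof. by rewrite mulr_gt0// ltr0n. Qed.

(** If [J] vanished, the bound would fail for large [s]. *)
Let J_gt0 : 0 < J.
Proof.
rewrite lt_def; apply/andP; split; last first.
  apply: fine_ge0; apply: integral_ge0 => x _; apply: mule_ge0.
    exact: legendre_ge0.
  by rewrite lee_fin expR_ge0.
apply/eqP => J0.
pose c := E + I * ln (\int[m]_(z in box n 1) v z) + n%:R * I.
(* this value of [s] turns the left-hand side into 1 *)
have := @main_bound (expR ((1 - c) / (n%:R * I))) 1 (expR_gt0 _) ltr01.
rewrite J0 mulr0 expRK mulrDr mulr1 addrA -/c mulrC divfK ?gt_eqF//.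
by rewrite subrKC ler10.
Qed.

Let L_bound s : 0 < s ->
  0 < L /\ E + I * ln L + n%:R * I * (1 + ln s) <= s `^ p * J.
Proof.
move=> s0.
pose X := (s `^ p * J - E - n%:R * I * (1 + ln s)) / I.
have [M M0|L0 LX] := andP (@Rintegral_le_box_bound _ _ v (expR X) cv v01 _).
  rewrite -ler_ln ?posrE ?expR_gt0 ?Rintegral_box_gt0// expRK.
  rewrite ler_pdivlMr// mulrC -subr_ge0.
  have := main_bound s0 M0; rewrite -subr_ge0 => H; apply: le_trans H _.
  by rewrite le_eqVlt; apply/orP; left; apply/eqP; ring.
split=> //.
have : ln L <= X by rewrite -[leRHS]expRK ler_ln ?posrE ?expR_gt0.
rewrite ler_pdivlMr// mulrC -subr_ge0 => H; rewrite -subr_ge0; apply: le_trans H _.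
by rewrite le_eqVlt; apply/orP; left; apply/eqP; ring.
Qed.

Lemma optimal_log_sobolev :
  E <= n%:R / p * I *
    ln (p / (n%:R * expR 1 `^ (p - 1) * L `^ (p / n%:R)) * (J / I)).
Proof.
apply: minimize_dilation => //.
- by rewrite ltr0n.
- exact: lt_trans ltr01 p_gt1.
- exact: (@L_bound 1 ltr01).1.
- by move=> s /L_bound[].
Qed.

End optimal_log_sobolev.

Theorem corollary3p2 (R : realType) (n : nat) (p q : R) (C g : 'rV[R]_n -> R)
    (n_gt0 : (0 < n)%N)
    (C_convex : strictly_convex C)
    (C_homogeneous : homogeneous q C)
    (pq : p^-1 + q^-1 = 1)
    (g_C1 : continuously_differentiable g)
    (int_expg : (lebesgue_rV n).-integrable setT (fun x => (expR (g x))%:E))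
    (int_ent : (lebesgue_rV n).-integrable setT (fun x =>
       (expR (g x) *
        ln (expR (g x) / \int[lebesgue_rV n]_y expR (g y)))%:E))
    (int_grad : (lebesgue_rV n).-integrable setT (fun x =>
       (legendre C (- grad g x) * (expR (g x))%:E)%E)) :
  let L := \int[lebesgue_rV n]_x expR (- C x) in
  let I := \int[lebesgue_rV n]_x expR (g x) in
  let J := fine (\int[lebesgue_rV n]_x
                   (legendre C (- grad g x) * (expR (g x))%:E)%E) in
  Ent (fun x => expR (g x)) <=
  n%:R / p * I *
  ln (p / (n%:R * expR 1 `^ (p - 1) * L `^ (p / n%:R)) * (J / I)).
Proof. exact: (optimal_log_sobolev n_gt0 C_convex C_homogeneous pq). Qed.
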